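(* Assume that $\theta>0$ is such that $\psi(\theta)<\infty$ and $$\mathbb E\Big(\sum_{|u|=1}e^{\theta V(u)}\log_+\sum_{|u|=1}e^{\theta V(u)}\Big)<\infty.$$ If the branching random walk is subcritical, i.e. $\psi(0)<0$, and satisfies $\mathbb E(Z_1(\mathbb R)\log_+Z_1(\mathbb R))<\infty$, then $\mathbb P(D^\theta_\infty(\mathbb R)<\infty)=1$.
   Context: Branching random walk. $\mathbb N=\{1,2,\dots\}$, $\mathbb T=\bigcup_{n\ge0}\mathbb N^n$ with $\mathbb N^0=\{\varnothing\}$; for $u=(u^{(1)},\dots,u^{(n)})\in\mathbb N^n$, $|u|=n$ and $u_k=(u^{(1)},\dots,u^{(k)})$ for $k\le n$. Let $\mathcal L$ be a point process on $\mathbb R$ (the reproduction law). Let $(z^{(u)}_k)_{k\ge1}$, $u\in\mathbb T$, be i.i.d. random non-increasing sequences with values in $\mathbb R\cup\{-\infty\}$ such that $\sum_{k\ge1}\delta_{z^{(u)}_k}$ is distributed as $\mathcal L$ (with $\delta_{-\infty}:=0$). The branching random walk is $V(\varnothing)=0$, $V(u)=\sum_{i=1}^{|u|}z^{(u_{i-1})}_{u^{(i)}}$ (with $-\infty+x=-\infty$). Vertices with $V(u)=-\infty$ are dead; all sums over $|u|=n$ are over living vertices ($V(u)>-\infty$) only. $Z_n=\sum_{|u|=n}\delta_{V(u)}$. It is assumed that $\mathbb P(Z_1(\mathbb R)=0)<1$. $\log_+(x)=\log(\max\{x,1\})$. $\psi(\theta)=\log\mathbb E\big(\sum_{|u|=1}e^{\theta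 V(u)}\big)$, so $\psi(0)=\log\mathbb E(Z_1(\mathbb R))$. Auxiliary point process. Let $((\hat\ell_i)_{i\ge1},\xi)$ be a random pair, $(\hat\ell_i)$ a non-increasing sequence in $\mathbb R\cup\{-\infty\}$ and $\xi\in\mathbb N$, with law given by $\mathbb E f((\hat\ell_i)_{i\ge1},\xi)=\mathbb E\big(\sum_{k\ge1}e^{\theta V(k)-\psi(\theta)}f((V(i))_{i\ge1},k)\big)$ for all non-negative measurable $f$, where $V(i)$, $i\in\mathbb N$, are the positions of the children of the root ($e^{-\infty}=0$). Let $((b_k(i))_{i\ge1},w^{(k)})_{k\ge1}$ be i.i.d. copies of $((\hat\ell_i)_{i\ge1},\xi)$, and, independently, let $(V^{(i,k)}(u):u\in\mathbb T)$, $i,k\ge1$, be i.i.d. copies of $(V(u):u\in\mathbb T)$. Put $S_n=\sum_{k=1}^nb_k(w^{(k)})$ and $$D^\theta_\infty=\delta_0+\sum_{k=1}^{\infty}\ \sum_{i\ne w^{(k)}}\ \sum_{|u|=k-1}\delta_{b_k(i)+V^{(i,k)}(u)-S_k}$$ (terms located at $-\infty$ are discarded). *)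

(* Defs.v *)
From HB Require Import structures.
From mathcomp Require Import all_boot all_order all_algebra.
From mathcomp Require Import all_classical all_reals all_analysis.
From mathcomp Require Import measurable_realfun.
Set Implicit Arguments.
Unset Strict Implicit.
Unset Printing Implicit Defensive.
Import Order.TTheory GRing.Theory Num.Theory.
Import numFieldNormedType.Exports.
Local Open Scope classical_set_scope.
Local Open Scope ring_scope.
Local Open Scope ereal_scope.

(* The function space [I -> T] with its product sigma-algebra, generated by
   the coordinate maps. *)
Definition cylinder (I : Type) (d : measure_display) (T : measurableType d)
    : set (set (I -> T)) :=
  [set C | exists i A, measurable A /\ C = [set f | A (f i)]].

Definition prodspace (I : Type) (d : measure_display) (T : measurableType d) :=
  g_sigma_algebraType (@cylinder I d T).

Section probability.
Context {R : realType}.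

Definition same_law {d1 d2 d : measure_display} {Omega1 : measurableType d1}
    {Omega2 : measurableType d2} {T : measurableType d}
    (P1 : probability Omega1 R) (X1 : Omega1 -> T)
    (P2 : probability Omega2 R) (X2 : Omega2 -> T) : Prop :=
  forall A, measurable A -> pushforward P1 X1 A = pushforward P2 X2 A.

Context {d : measure_display} {Omega : measurableType d}.
Variable P : probability Omega R.

Definition independent2 {d1 d2 : measure_display} {T1 : measurableType d1}
    {T2 : measurableType d2} (X : Omega -> T1) (Y : Omega -> T2) : Prop :=
  forall A B, measurable A -> measurable B ->
    P (X @^-1` A `&` Y @^-1` B) = P (X @^-1` A) * P (Y @^-1` B).

Definition independent {I : choiceType} {d' : measure_display}
    {T : measurableType d'} (X : I -> Omega -> T) : Prop :=
  forall (J : seq I) (A : I -> set T), uniq J ->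
    (forall i, measurable (A i)) ->
    P (\bigcap_(i in [set` J]) (X i @^-1` A i)) =
      \prod_(i <- J) P (X i @^-1` A i).

Definition iid {I : choiceType} {d' : measure_display}
    {T : measurableType d'} (X : I -> Omega -> T) : Prop :=
  [/\ forall i, measurable_fun setT (X i),
      independent X &
      forall i j, same_law P (X i) P (X j)].

End probability.

Section branching_random_walk.
Context {R : realType}.

(* Random sequences are indexed by [nat], and a vertex of the Ulam-Harris tree
   is a list of natural numbers: ranks of children start at 0, not at 1. *)
Definition sequence_space := prodspace nat (\bar R).
Definition field_space := prodspace (seq nat) (\bar R).

(* Non-increasing sequences with values in R u {-oo}. *)
Definition ranked (x : nat -> \bar R) : Prop :=
  (forall k, x k < +oo) /\ (forall k, x k.+1 <= x k).

(* The point mass at [x], with the convention that it is zero unless [x] is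
   a real number. *)
Definition atom (x : \bar R) (A : set R) : \bar R :=
  if x is r%:E then \d_r A else 0.

Definition log_plus (x : \bar R) : \bar R := lne (maxe x 1).

Section walk.
Context {d : measure_display} {Omega : measurableType d}.
Variable P : probability Omega R.
Variable z : seq nat -> Omega -> sequence_space.

Definition reproduction_family : Prop :=
  (forall u omega, ranked (z u omega)) /\ iid P z.

Definition brw (omega : Omega) : field_space :=
  fun u => \sum_(i < size u) z (take i u) omega (nth 0%N u i).

Definition Z (n : nat) (omega : Omega) (A : set R) : \bar R :=
  \esum_(u in [set u : seq nat | size u = n]) atom (brw omega u) A.

(* The sum of e^(theta V(u)) over the living vertices of generation n; the
   restriction to living vertices matters when theta = 0. *)
Definition expsum (theta : R) (n : nat) (omega : Omega) : \bar R :=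
  \esum_(u in [set u : seq nat | size u = n /\ -oo < brw omega u])
    expeR (theta%:E * brw omega u).

Definition psi (theta : R) : \bar R :=
  lne (\int[P]_omega expsum theta 1 omega).

Definition children (omega : Omega) : sequence_space :=
  fun i => brw omega [:: i].

(* The size-biased law of a reproduction sequence with a marked child, the
   mark k having weight e^(theta V(k) - psi(theta)); dead children get weight
   e^(-oo) = 0 when 0 < theta. *)
Definition has_tilted_law (theta : R) {d' : measure_display}
    {Omega' : measurableType d'} (P' : probability Omega' R)
    (lhat : Omega' -> sequence_space) (xi : Omega' -> nat) : Prop :=
  forall f : sequence_space * nat -> \bar R,
    measurable_fun setT f -> (forall x, 0 <= f x) ->
    \int[P']_omega f (lhat omega, xi omega) =
    \int[P]_omega \sum_(k <oo)
      (expeR (theta%:E * children omega k - psi theta) *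
       f (children omega, k)).

End walk.

Section decoration.
Context {d : measure_display} {Omega : measurableType d}.
Variables (b : nat -> Omega -> sequence_space) (w : nat -> Omega -> nat).
Variable V : nat * nat -> Omega -> field_space.

Definition spine_sum (n : nat) (omega : Omega) : \bar R :=
  \sum_(k < n) b k omega (w k omega).

(* [V (i, k)] is the walk attached to the i-th sibling of the marked child in
   [b k].  The index k starts at 0, so that it stands for the k+1 of the usual
   1-based indexing: generation k, shifted by [spine_sum k.+1]. *)
Definition Dinf (omega : Omega) (A : set R) : \bar R :=
  \d_(0 : R)%R A +
  \sum_(k <oo) \esum_(i in [set i | i <> w k omega])
    \esum_(u in [set u : seq nat | size u = k])
      atom (b k omega i + V (i, k) omega u - spine_sum k.+1 omega) A.

End decoration.

End branching_random_walk.

Arguments sequence_space : clear implicits.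
Arguments field_space : clear implicits.

(* Main.v *)
(** Let m < 1 be the mean offspring number, N_k the number of living points of
    b_k, and a = 2 / (1 + m), so that a > 1 and a m < 1.  Under the tilted law
    log_+ N_k has finite expectation, because
    W log_+ N <= W log_+ W + N log_+ N; hence by Borel-Cantelli there is almost
    surely a finite C such that N_k <= C a^k for all k.  For a fixed C, the walks
    attached to those b_k with N_k <= C a^k are independent of b, so the expected
    number of their living particles of generation k is at most
    C a^k m^k, which is summable. *)

Require Import Defs.
From mathcomp Require Import all_boot all_order all_algebra.
From mathcomp Require Import all_classical all_reals all_analysis.
From mathcomp Require Import measurable_realfun.
From mathcomp Require Import lra.
Set Implicit Arguments.
Unset Strict Implicit.
Unset Printing Implicit Defensive.
Import Order.TTheory GRing.Theory Num.Theory.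
Local Open Scope classical_set_scope.
Local Open Scope ring_scope.
Local Open Scope ereal_scope.

(** * Boolean indicators with extended real values *)

Section indicator.
Context {R : realType}.

Definition ind (b : bool) : \bar R := if b then 1 else 0.

Lemma ind_ge0 (b : bool) : 0 <= ind b. Proof. by case: b => //=; exact: lee01. Qed.

Lemma ind_le1 (b : bool) : ind b <= 1. Proof. by case: b => //=; exact: lee01. Qed.

Lemma ind_and (b c : bool) : ind (b && c) = ind b * ind c.
Proof. by case: b; rewrite /= ?mul1e ?mul0e. Qed.

Context {d : measure_display} {Omega : measurableType d}.

Lemma measurable_ind (b : Omega -> bool) :
  measurable_fun setT b -> measurable_fun setT (fun omega => ind (b omega)).
Proof. by move=> mb; exact: measurable_fun_ifT. Qed.

Lemma measurable_bool_set (b : Omega -> bool) :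
  measurable_fun setT b -> measurable [set omega | b omega].
Proof. by move=> mb; rewrite -[X in measurable X]setTI; exact: (mb _ [set true]). Qed.

Lemma integral_ind (P : {measure set Omega -> \bar R}) (b : Omega -> bool) :
  measurable_fun setT b ->
  \int[P]_omega ind (b omega) = P [set omega | b omega].
Proof.
move=> mb.
have := integral_indic P measurableT (measurable_bool_set mb); rewrite setIT => <-.
apply: eq_integral => omega _; rewrite indicE /ind.
by case: ifPn => bo; [rewrite mem_set|rewrite memNset//=; exact/negP].
Qed.

End indicator.

(** * Nonnegative sums over a countable type: measurability and Tonelli *)

Section countable_esum.
Context {R : realType} {T : countType}.

(** Rewriting the unordered sum as a series along the enumeration [pickle] makes the series theorems
    (scaling, measurability, monotone convergence) available. Indices outside the image of [A]
    receive the value 0. *)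
Lemma esum_pickle (A : set T) (f : T -> \bar R) :
  (forall t, 0 <= f t) ->
  \esum_(t in A) f t =
  \sum_(n <oo) if n \in pickle @` A then oapp f 0 (unpickle n) else 0.
Proof.
move=> f0; rewrite nneseries_esumT; last first.
  by move=> n; case: ifP => // _; case: unpickle => /=.
rewrite -esum_mkcond esum_image//; last first.
  by move=> x y _ _; exact: (pcan_inj pickleK).
by apply: eq_esum => t _; rewrite pickleK.
Qed.

Lemma ge0_esumZl (A : set T) (f : T -> \bar R) (x : \bar R) :
  (forall t, 0 <= f t) -> 0 <= x -> x \is a fin_num ->
  \esum_(t in A) (x * f t) = x * \esum_(t in A) f t.
Proof.
move=> f0 x0 xfin; rewrite !esum_pickle//; last by move=> t; rewrite mule_ge0.
rewrite -[in RHS](fineK xfin) -nneseriesZl; last first.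
  by move=> n _; case: ifP => // _; case: unpickle => /=.
apply: eq_eseriesr => n _; rewrite fineK//.
case: ifP => _; last by rewrite mule0.
by case: unpickle => /= [t|]; rewrite ?mule0.
Qed.

Context {d : measure_display} {Omega : measurableType d}.
Variables (A : set T) (f : T -> Omega -> \bar R).
Hypotheses (mf : forall t, measurable_fun setT (f t))
  (f0 : forall t omega, 0 <= f t omega).

Lemma measurable_esum :
  measurable_fun setT (fun omega => \esum_(t in A) f t omega).
Proof.
under eq_fun do rewrite esum_pickle//.
apply: (ge0_emeasurable_sum (P := xpredT)) => n.
  by move=> omega _ _; case: ifP => // _; case: unpickle => /=.
move=> _; case: (n \in _) => //.
by case: (unpickle n).
Qed.

Lemma ge0_integral_esum (P : {measure set Omega -> \bar R}) :
  \int[P]_omega (\esum_(t in A) f t omega) =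
  \esum_(t in A) \int[P]_omega f t omega.
Proof.
under eq_integral do rewrite esum_pickle//.
rewrite integral_nneseries//.
- rewrite esum_pickle; last by move=> t; exact: integral_ge0.
  apply: eq_eseriesr => n _; case: ifP => [_|_]; last exact: integral0.
  by case: unpickle => //=; exact: integral0.
- by move=> n; case: (n \in _) => //; case: (unpickle n).
- by move=> n omega _; case: ifP => // _; case: unpickle => /=.
Qed.

End countable_esum.

(** * Measurability in the product sigma-algebra *)

Section measurable_prodspace.
Context {I : Type} {d : measure_display} {T : measurableType d}.

Lemma measurable_coordinate (i : I) :
  measurable_fun setT (fun f : prodspace I T => f i).
Proof.
move=> _ A mA; rewrite setTI; apply: sub_sigma_algebra.
by exists i, A.
Qed.

Lemma measurable_prodspaceP {d' : measure_display} {Omega : measurableType d'}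
    (X : Omega -> prodspace I T) :
  measurable_fun setT X <-> forall i, measurable_fun setT (fun omega => X omega i).
Proof.
split=> [mX i|mX].
  by apply: (measurableT_comp (measurable_coordinate i) mX).
apply: (@measurability _ _ _ _ setT X (@cylinder I d T) erefl) => _ [_ [i [A [mA ->]]] <-].
exact: mX.
Qed.

End measurable_prodspace.

(** * Extended exponential and logarithm; counting exceedances of a geometric sequence *)

Section ereal_exp_log.
Context {R : realType}.

Lemma measurable_expeR : measurable_fun setT (@expeR R).
Proof.
rewrite (_ : expeR = fun x => if x == +oo then +oo else if x == -oo then 0 else
  (expR (fine x))%:E); last by apply/funext => -[].
apply: measurable_fun_ifT => //; first exact: measurable_fun_eqe.
apply: measurable_fun_ifT => //; first exact: measurable_fun_eqe.
by apply/measurable_EFinP; apply: measurableT_comp => //; exact: measurable_fine.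
Qed.

Lemma measurable_log_plus : measurable_fun setT (@log_plus R).
Proof.
rewrite (_ : log_plus = fun x => if x == +oo then +oo else
  (* The default [fine -oo = 0] gives [ln 1 = 0], the correct value at [-oo]; only [+oo] needs its
     own branch. *)
  (ln (Num.max (fine x) 1))%:E); last first.
  apply/funext => -[x| |]/=; rewrite /log_plus /=.
  - rewrite -EFin_max /lne ifF//; apply/negbTE; rewrite -ltNge.
    by rewrite lt_max ltr01 orbT.
  - by [].
  - by rewrite max_r ?leNye// lne1 max_r ?ler01// ln1.
apply: measurable_fun_ifT => //; first exact: measurable_fun_eqe.
apply/measurable_EFinP; apply: measurableT_comp => //.
by apply: measurable_maxr => //; exact: measurable_fine.
Qed.

Lemma log_plus_ge0 (x : \bar R) : 0 <= log_plus x.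
Proof. by rewrite /log_plus lne_ge0 le_max lexx orbT. Qed.

Lemma le_log_plus (x y : \bar R) : x <= y -> log_plus x <= log_plus y.
Proof.
move=> xy; rewrite /log_plus lee_lne ?in_itv/= ?leey ?andbT ?le_max ?lee01 ?orbT//.
rewrite !ge_max xy lexx andbT /=.
by case: leP => // /ltW y1; rewrite (le_trans xy y1).
Qed.

(** By monotonicity of [log_plus], the left side is at most the term of the larger of [x] and [y].
    This separates a mixed moment into two moments that are assumed finite. *)
Lemma mule_log_plus_le (x y : \bar R) : 0 <= x -> 0 <= y ->
  x * log_plus y <= x * log_plus x + y * log_plus y.
Proof.
move=> x0 y0; have [yx|/ltW xy] := leP y x.
  apply: (@le_trans _ _ (x * log_plus x)).
    by apply: lee_wpmul2l => //; exact: le_log_plus.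
  by rewrite leeDl// mule_ge0// log_plus_ge0.
apply: (@le_trans _ _ (y * log_plus y)).
  by apply: lee_wpmul2r => //; exact: log_plus_ge0.
by rewrite leeDr// mule_ge0// log_plus_ge0.
Qed.

(** The inequality [e^(cn) < x] forces [n <= log_plus x / c], and the extra 1 accounts for the index
    0. *)
Lemma exceedance_count_le (c : R) (x : \bar R) (N : nat) : (0 < c)%R ->
  \sum_(0 <= n < N) ind ((expR c ^+ n)%:E < x) <=
  1 + (c^-1)%:E * log_plus x.
Proof.
move=> c0; elim: N => [|N IH].
  by rewrite big_geq// adde_ge0// mule_ge0 ?log_plus_ge0 ?lee_fin ?invr_ge0 ?ltW.
rewrite big_nat_recr//=; case: (ltP _ x) => [Nx|xN]; last by rewrite adde0.
have -> : 1 + (c^-1)%:E * log_plus x = (c^-1)%:E * log_plus x + 1 by rewrite addeC.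
apply: leeD => //.
(* When index [N] is itself an exceedance, the [N] earlier indicators are bounded trivially by 1
   each, and [c N <= log_plus x] follows by taking logarithms. *)
apply: (@le_trans _ _ (\sum_(0 <= n < N) 1)).
  by apply: lee_sum => n _; exact: ind_le1.
rewrite sumEFin big_const_nat subn0 iter_addr addr0.
rewrite -(@lee_pmul2l _ c%:E)// ?lte_fin// muleA -(EFinM c c^-1) divff ?gt_eqF// mul1e.
have -> : c%:E * N%:R%:E = lne (expR c ^+ N)%:E.
  by rewrite lne_EFin ?exprn_gt0 ?expR_gt0// -expRM_natr expRK -EFinM.
apply: le_trans (le_log_plus (ltW Nx)).
by rewrite /log_plus lee_lne ?in_itv/= ?leey ?andbT ?le_max ?lee01 ?orbT ?lexx//
  lee_fin exprn_ge0// ltW// expR_gt0.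
Qed.

(** Weighted form for the full series: under the size-biased law the weight [w] is the exponential
    sum of the first generation. *)
Lemma mule_exceedance_count_le (c : R) (w x : \bar R) : (0 < c)%R -> 0 <= w ->
  \sum_(n <oo) (w * ind ((expR c ^+ n)%:E < x)) <=
  w + (c^-1)%:E * (w * log_plus x).
Proof.
move=> c0 w0; apply: lime_le.
  by apply: is_cvg_nneseries => n _ _; rewrite mule_ge0// ind_ge0.
apply: nearW => N.
rewrite -ge0_sume_distrr; last by move=> n _; exact: ind_ge0.
rewrite muleCA -[X in X + _]mule1 -ge0_muleDr.
- by apply: lee_wpmul2l => //; exact: exceedance_count_le.
- exact: lee01.
- by rewrite mule_ge0 ?log_plus_ge0// lee_fin invr_ge0 ltW.
Qed.

End ereal_exp_log.

(** * Almost sure statements and the first Borel-Cantelli lemma *)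

Section almost_sure.
Context {R : realType} {d : measure_display} {Omega : measurableType d}.
Variable P : probability Omega R.

Lemma ae_probability1 (A : set Omega) :
  measurable A -> {ae P, forall omega, A omega} -> P A = 1.
Proof.
move=> mA [N [mN PN0 AN]].
apply/eqP; rewrite eq_le probability_le1//= -(sube0 1) -PN0 -probability_setC//.
apply: le_measure; rewrite ?inE//; first exact: measurableC.
by move=> omega /= nN; apply: contrapT => nA; exact/nN/AN.
Qed.

Lemma ae_lty (f : Omega -> \bar R) : measurable_fun setT f ->
  (forall omega, 0 <= f omega) -> \int[P]_omega f omega < +oo ->
  {ae P, forall omega, f omega < +oo}.
Proof.
move=> mf f0 intf.
have /integrable_ae : P.-integrable setT f.
  by apply/integrableP; split => //; under eq_integral do rewrite gee0_abs//.
move=> /(_ measurableT); apply: filterS => omega /(_ Logic.I).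
by rewrite ge0_fin_numE.
Qed.

Lemma borel_cantelli (A : nat -> set Omega) : (forall n, measurable (A n)) ->
  \sum_(n <oo) P (A n) < +oo ->
  {ae P, forall omega, exists K, forall n, (K <= n)%N -> ~ A n omega}.
Proof.
move=> mA sumA.
exists (lim_sup_set A); split.
- apply: bigcap_measurable => // n _; exact: bigcup_measurable.
- exact: lim_sup_set_cvg0.
- move=> omega /= nev K _; apply: contrapT => nA; apply: nev; exists K => n Kn An.
  by apply: nA; exists n.
Qed.

End almost_sure.

(** * Survival probability of a vertex and sums of products over a generation *)

Section generation_size.
Context {R : realType} {d : measure_display} {Omega : measurableType d}.
Variables (P : probability Omega R) (z : seq nat -> Omega -> sequence_space R).
Hypothesis z_iid : iid P z.

Lemma measurable_reproduction (u : seq nat) (j : nat) :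
  measurable_fun setT (fun omega => z u omega j).
Proof. by case: z_iid => mz _ _; exact: (measurableT_comp (measurable_coordinate j) (mz u)). Qed.

Lemma measurable_alive {d' : measure_display} {Omega' : measurableType d'}
    (X : Omega' -> \bar R) :
  measurable_fun setT X -> measurable_fun setT (fun omega => -oo < X omega).
Proof. by move=> mX; exact: measurable_fun_lte. Qed.

(** The value [-oo] is absorbing for addition in [\bar R], even against [+oo], so a vertex is dead
    exactly when some step on its path is [-oo]. *)
Lemma brw_aliveE (omega : Omega) (u : seq nat) :
  (-oo < brw z omega u) =
  all (fun i => -oo < z (take i u) omega (nth 0%N u i)) (iota 0 (size u)).
Proof.
rewrite ltNye; apply/idP/allP => [/negP h i|h].
  rewrite mem_iota add0n => /= iu; rewrite ltNye; apply/eqP => zi; apply: h.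
  by rewrite esum_eqNy; apply/existsP; exists (Ordinal iu); rewrite /= zi eqxx.
apply/negP; rewrite esum_eqNy => /existsP[i] /= /eqP zi.
by have := h i; rewrite mem_iota add0n ltn_ord zi ltxx => /(_ isT).
Qed.

(** The steps towards [u] use the reproduction sequences of its proper prefixes. These are distinct
    vertices, so the steps are independent, and each sequence has the law of the one at the root. *)
Lemma brw_alive_prob (u : seq nat) :
  P [set omega | -oo < brw z omega u] =
  \prod_(j <- u) P [set omega | -oo < z [::] omega j].
Proof.
case: z_iid => mz z_indep z_law.
pose J := [seq take i u | i <- iota 0 (size u)].
(* Independence asks for an event at every vertex. A prefix of [u] is determined by its length, so
   [size v] recovers the rank of the next child on the path. *)
pose A (v : seq nat) : set (sequence_space R) := [set x | -oo < x (nth 0%N u (size v))].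
have size_J i : i \in iota 0 (size u) -> size (take i u) = i.
  by rewrite mem_iota add0n => /= iu; rewrite size_take iu.
have uJ : uniq J.
  rewrite map_inj_in_uniq ?iota_uniq// => i j iu ju eq_ij.
  by rewrite -(size_J i)// -(size_J j)// eq_ij.
have mA v : measurable (A v).
  by apply: measurable_bool_set; apply: measurable_alive; exact: measurable_coordinate.
have := z_indep J A uJ mA.
have -> : \bigcap_(i in [set` J]) z i @^-1` A i = [set omega | -oo < brw z omega u].
  apply/seteqP; split => omega /=; rewrite brw_aliveE.
    move=> h; apply/allP => i iu.
    have := h (take i u); rewrite /A /= size_J//; apply.
    exact: map_f.
  move=> /allP h _ /mapP[i iu ->]; rewrite /A /= size_J//.
  exact: h.
move=> ->; rewrite big_map [RHS](big_nth 0%N) /index_iota subn0.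
apply: eq_big_seq => i iu.
have := z_law (take i u) [::] (A (take i u)) (mA _).
by rewrite /pushforward /A /preimage /= size_J.
Qed.

(** Induction on [n]: a word of length [n + 1] is a pair of a head and a tail, and the double sum
    factorises. *)
Lemma esum_prod_size (p : nat -> \bar R) (n : nat) : (forall j, 0 <= p j) ->
  (forall j, p j \is a fin_num) -> \esum_(j in setT) p j \is a fin_num ->
  \esum_(u in [set u : seq nat | size u = n]) \prod_(j <- u) p j =
  (\esum_(j in setT) p j) ^+ n.
Proof.
move=> p0 pfin sumfin; elim: n => [|n IH].
  rewrite (_ : [set u | _] = [set [::]]) ?esum_set1 ?big_nil ?expe0//.
  by apply/seteqP; split => u /=; [move/size0nil|move=> ->].
have prod_ge0 (u : seq nat) : 0 <= \prod_(j <- u) p j.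
  by apply: prode_ge0.
rewrite expeS -IH.
rewrite (reindex_esum (setT `*`` (fun _ : nat => [set u : seq nat | size u = n])) _
  (fun ju => ju.1 :: ju.2)); last first.
  split => [[j u] [_ /= <-]//|[j u] [k v] _ _ /= [-> ->]//|[|j u]//= [su]].
  by exists (j, u).
rewrite -(@esum_esum _ _ _ _ _ (fun j u => \prod_(i <- j :: u) p i)); last first.
  by move=> i j _ _; exact: prod_ge0.
rewrite muleC -ge0_esumZl//.
- apply: eq_esum => j _; rewrite muleC -ge0_esumZl//.
  by apply: eq_esum => u _; rewrite big_cons.
- exact: esum_ge0.
- by rewrite IH fin_numX.
Qed.

End generation_size.

(** * Number of living children and mean generation sizes *)

Section first_generation.
Context {R : realType} {d : measure_display} {Omega : measurableType d}.
Variables (P : probability Omega R) (z : seq nat -> Omega -> sequence_space R).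
Hypothesis z_family : reproduction_family P z.

(** Defined on sequences rather than on the walk, so that it applies both to the children of the
    root and to the size-biased sequences [b k]. *)
Definition alive_count (x : sequence_space R) : \bar R :=
  \esum_(i in setT) ind (-oo < x i).

Lemma alive_count_ge0 (x : sequence_space R) : 0 <= alive_count x.
Proof. by apply: esum_ge0 => i _; exact: ind_ge0. Qed.

Lemma measurable_alive_count : measurable_fun setT alive_count.
Proof.
apply: measurable_esum => i; last by move=> x; exact: ind_ge0.
by apply: measurable_ind; apply: measurable_alive; exact: measurable_coordinate.
Qed.

Lemma esum_singleton_seq (f : seq nat -> \bar R) :
  \esum_(u in [set u : seq nat | size u = 1%N]) f u = \esum_(i in setT) f [:: i].
Proof.
apply: reindex_esum; split => [i _//|i j _ _ [->]//|[|i [|//]]//= _].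
by exists i.
Qed.

Lemma brw1E (omega : Omega) (i : nat) : brw z omega [:: i] = z [::] omega i.
Proof. by rewrite /brw /= big_ord1. Qed.

Lemma childrenE (omega : Omega) : children z omega = z [::] omega.
Proof. by apply/funext => i; exact: brw1E. Qed.

Lemma Z1E (omega : Omega) : Z z 1 omega setT = alive_count (z [::] omega).
Proof.
rewrite /Z esum_singleton_seq; apply: eq_esum => i _.
rewrite -/(children z omega i) childrenE /atom /ind.
have [/(_ [::] omega)[/(_ i) + _] _] := z_family.
by case: (z [::] omega i) => //= r _; rewrite ltNyr diracT.
Qed.

Lemma expsum1E (theta : R) (omega : Omega) : (0 < theta)%R ->
  expsum z theta 1 omega =
  \esum_(i in setT) expeR (theta%:E * z [::] omega i).
Proof.
move=> theta0; rewrite /expsum esum_mkcondr esum_singleton_seq.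
apply: eq_esum => i _; rewrite brw1E.
case: ifPn => // /negP zi; rewrite (_ : z [::] omega i = -oo) ?gt0_muleNy ?lte_fin//.
apply/eqP; rewrite -leeNy_eq leNgt; apply/negP => zi'; apply: zi.
by rewrite inE /= brw1E.
Qed.

Lemma expsum0_1E (omega : Omega) :
  expsum z 0 1 omega = alive_count (z [::] omega).
Proof.
rewrite /expsum esum_mkcondr esum_singleton_seq.
apply: eq_esum => i _; rewrite brw1E.
rewrite mul0e expeR0 /ind; case: ifPn; first by rewrite inE /= brw1E => ->.
by rewrite notin_setE /= brw1E => /negP/negbTE ->.
Qed.

Lemma measurable_expsum1 (theta : R) : (0 < theta)%R ->
  measurable_fun setT (expsum z theta 1).
Proof.
move=> theta0; have [_ z_iid] := z_family.
rewrite (_ : expsum z theta 1 = fun omega => \esum_(i in setT)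
  expeR (theta%:E * z [::] omega i)); last by apply/funext => omega; exact: expsum1E.
apply: measurable_esum => i; last by move=> omega; exact: expeR_ge0.
apply: measurableT_comp; first exact: measurable_expeR.
apply: emeasurable_funM => //.
exact: measurable_reproduction z_iid _ _.
Qed.

Lemma expsum_ge0 (theta : R) (n : nat) (omega : Omega) : 0 <= expsum z theta n omega.
Proof. by apply: esum_ge0 => u _; exact: expeR_ge0. Qed.

Lemma measurable_first_generation : measurable_fun setT (z [::]).
Proof. by have [_ [mz _ _]] := z_family. Qed.

Lemma measurable_first_generation_count :
  measurable_fun setT (fun omega => alive_count (z [::] omega)).
Proof. exact: (measurableT_comp measurable_alive_count measurable_first_generation). Qed.

Lemma mean_offspringE :
  \int[P]_omega expsum z 0 1 omega =
  \esum_(j in setT) P [set omega | -oo < z [::] omega j].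
Proof.
have [_ z_iid] := z_family.
have m_alive j := measurable_alive (measurable_reproduction z_iid [::] j).
under eq_integral do rewrite expsum0_1E.
rewrite ge0_integral_esum//; last by move=> j omega; exact: ind_ge0.
  by apply: eq_esum => j _; rewrite integral_ind.
by move=> j; exact: measurable_ind.
Qed.

(** The expected size of generation [n] is the [n]-th power of the mean offspring number: sum the
    survival probabilities, which are products along paths. *)
Lemma mean_generation_size (n : nat) :
  \int[P]_omega expsum z 0 1 omega \is a fin_num ->
  \esum_(u in [set u : seq nat | size u = n]) P [set omega | -oo < brw z omega u] =
  (\int[P]_omega expsum z 0 1 omega) ^+ n.
Proof.
have [_ z_iid] := z_family.
rewrite mean_offspringE => mfin; rewrite -esum_prod_size//.
  by apply: eq_esum => u _; exact: brw_alive_prob.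
move=> j; apply: fin_num_measure; apply: measurable_bool_set; apply: measurable_alive.
exact: measurable_reproduction z_iid _ _.
Qed.

End first_generation.

(** * Finiteness of the normalisation and the size-biased change of measure *)

Section tilted_prob.
Context {R : realType} {d0 : measure_display} {Omega0 : measurableType d0}.
Variables (P0 : probability Omega0 R) (z : seq nat -> Omega0 -> sequence_space R).
Variable theta : R.
Hypotheses (z_family : reproduction_family P0 z) (theta_gt0 : (0 < theta)%R)
  (psi_theta_lty : psi P0 z theta < +oo).

Lemma mean_expsum_lty : \int[P0]_omega expsum z theta 1 omega < +oo.
Proof. by move: psi_theta_lty; rewrite /psi; case: integral => //= *; exact: ltry. Qed.

(** If [psi] were [-oo], the exponential sum would have mean 0 and vanish almost surely, so almost
    surely no child would be alive, against the hypothesis. *)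
Lemma psi_fin_num : P0 [set omega | Z z 1 omega setT = 0] < 1 ->
  psi P0 z theta \is a fin_num.
Proof.
move=> z_nontrivial; rewrite fin_numE (lt_eqF psi_theta_lty) andbT.
apply/negP => /eqP psiNy; move: z_nontrivial; rewrite ltNge => /negP; apply.
have W0 : \int[P0]_omega expsum z theta 1 omega = 0.
  have : 0 <= \int[P0]_omega expsum z theta 1 omega.
    by apply: integral_ge0 => omega _; exact: expsum_ge0.
  move: psiNy; rewrite /psi; case: integral => //= r; case: ifPn => // r0 _.
  by rewrite lee_fin => r0'; congr _%:E; apply/eqP; rewrite eq_le r0.
have mW := measurable_expsum1 z_family theta_gt0.
rewrite (@ae_probability1 _ _ _ P0)//.
  rewrite (_ : [set _ | _] = [set omega | alive_count (z [::] omega) == 0]).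
    apply: measurable_bool_set; apply: measurable_fun_eqe => //.
    exact: (measurable_first_generation_count z_family).
  by apply/seteqP; split => omega /=; rewrite (Z1E z_family) => /eqP.
have : ae_eq P0 setT (expsum z theta 1) (cst 0).
  apply/(ae_eq_integral_abs _ _ mW) => //.
  by under eq_integral do rewrite gee0_abs ?expsum_ge0//.
apply: filterS => omega /(_ Logic.I) /=; rewrite (Z1E z_family) expsum1E// => W_0.
apply: esum1 => i _.
have : expeR (theta%:E * z [::] omega i) <= 0.
  rewrite -W_0; apply: esum_ge; exists [set i] => //.
  by rewrite fsbig_set1.
(* A nonpositive exponential leaves only the value [-oo], whose indicator is 0. *)
case: (z [::] omega i) => [r| |] //=; first by rewrite lee_fin leNgt expR_gt0.
by rewrite gt0_muley ?lte_fin.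
Qed.

Context {d : measure_display} {Omega : measurableType d}.
Variables (P : probability Omega R) (b : Omega -> sequence_space R) (w : Omega -> nat).
Hypotheses (psi_fin : psi P0 z theta \is a fin_num)
  (bw_law : has_tilted_law P0 z theta P b w) (mb : measurable_fun setT b).

(** For an event that ignores the mark, the weights of all possible marks add up to the exponential
    sum times [e^(-psi)]. *)
Lemma tilted_prob (h : sequence_space R -> bool) : measurable_fun setT h ->
  P [set omega | h (b omega)] =
  expeR (- psi P0 z theta) *
  \int[P0]_omega (expsum z theta 1 omega * ind (h (z [::] omega))).
Proof.
move=> mh; rewrite -integral_ind; last exact: measurableT_comp.
rewrite (bw_law (f := fun x => ind (h x.1))); last 2 first.
- by apply: measurable_ind; apply: measurableT_comp.
- by move=> x; exact: ind_ge0.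
have psiN_fin : expeR (- psi P0 z theta) \is a fin_num by case: (psi P0 z theta) psi_fin.
rewrite -ge0_integralZl//; last 3 first.
- apply: (emeasurable_funM (measurable_expsum1 z_family theta_gt0)).
  apply: measurable_ind; apply: (measurableT_comp mh).
  exact: (measurable_first_generation z_family).
- by move=> omega _; rewrite mule_ge0 ?expsum_ge0 ?ind_ge0.
- exact: expeR_ge0.
apply: eq_integral => omega _; rewrite childrenE /= expsum1E//.
rewrite nneseries_esumT; last by move=> k; rewrite mule_ge0 ?expeR_ge0 ?ind_ge0.
rewrite [in RHS]muleC -muleA [in RHS]muleC -ge0_esumZl.
- apply: eq_esum => i _; rewrite expeRD muleC [_ * expeR (- _)]muleC muleA.
  by [].
- by move=> i; exact: expeR_ge0.
- by rewrite mule_ge0 ?ind_ge0 ?expeR_ge0.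
- by rewrite fin_numM// /ind; case: (h _).
Qed.

End tilted_prob.

(** * Summable tails of the number of living points under the size-biased law *)

Section tilted_tail.
Context {R : realType} {d0 : measure_display} {Omega0 : measurableType d0}.
Variables (P0 : probability Omega0 R) (z : seq nat -> Omega0 -> sequence_space R).
Variable theta : R.
Hypotheses (z_family : reproduction_family P0 z) (theta_gt0 : (0 < theta)%R)
  (psi_theta_lty : psi P0 z theta < +oo).
Context {d : measure_display} {Omega : measurableType d}.
Variables (P : probability Omega R) (b : nat -> Omega -> sequence_space R)
  (w : nat -> Omega -> nat).
Hypotheses (psi_fin : psi P0 z theta \is a fin_num)
  (bw_law : forall n, has_tilted_law P0 z theta P (b n) (w n))
  (mb : forall n, measurable_fun setT (b n)).
Hypotheses
  (xlogx_theta : \int[P0]_omega (expsum z theta 1 omega *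
                   log_plus (expsum z theta 1 omega)) < +oo)
  (xlogx_Z : \int[P0]_omega (Z z 1 omega setT * log_plus (Z z 1 omega setT)) < +oo).

(** With [W] the exponential sum and [N] the offspring number, the change of measure turns the
    series into [e^(-psi)] times the mean of [W] times the number of [n] with [e^(cn) < N]. *)
Lemma alive_count_tail_summable (c : R) : (0 < c)%R ->
  \sum_(n <oo) P [set omega | (expR c ^+ n)%:E < alive_count (b n omega)] < +oo.
Proof.
move=> c0.
pose W := expsum z theta 1.
pose N omega := alive_count (z [::] omega).
have mW : measurable_fun setT W := measurable_expsum1 z_family theta_gt0.
have mN : measurable_fun setT N := measurable_first_generation_count z_family.
have cV0 : 0 <= (c^-1)%:E by rewrite lee_fin invr_ge0 ltW.
have W0 omega : 0 <= W omega by exact: expsum_ge0.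
have N0 omega : 0 <= N omega by exact: alive_count_ge0.
have m_exceed n : measurable_fun setT
    (fun x : sequence_space R => (expR c ^+ n)%:E < alive_count x).
  by apply: measurable_fun_lte => //; exact: measurable_alive_count.
have m_exceedN n : measurable_fun setT (fun omega => ind ((expR c ^+ n)%:E < N omega)).
  by apply: measurable_ind; apply: measurable_fun_lte.
have mlogW : measurable_fun setT (fun omega => W omega * log_plus (W omega)).
  by apply: (emeasurable_funM mW); exact: (measurableT_comp (@measurable_log_plus R)).
have mlogN : measurable_fun setT (fun omega => N omega * log_plus (N omega)).
  by apply: (emeasurable_funM mN); exact: (measurableT_comp (@measurable_log_plus R)).
have psiN_fin : expeR (- psi P0 z theta) \is a fin_num by case: (psi P0 z theta) psi_fin.
under eq_eseriesr => n _ do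
  rewrite (tilted_prob z_family theta_gt0 psi_fin (bw_law n) (mb n) (m_exceed n)).
under eq_eseriesr => n _ do rewrite -[X in X * _](fineK psiN_fin).
rewrite nneseriesZl; last first.
  by move=> n _; apply: integral_ge0 => omega _; rewrite mule_ge0 ?ind_ge0.
apply: lte_mul_pinfty; first by rewrite fineK// expeR_ge0.
  by [].
rewrite -integral_nneseries//; last 2 first.
- by move=> n; exact: emeasurable_funM.
- by move=> n omega _; rewrite mule_ge0 ?ind_ge0.
(* The exceedance count is at most [1 + log_plus N / c], and [W log_plus N] is split into the two
   moments assumed finite. *)
apply: (@le_lt_trans _ _ (\int[P0]_omega (W omega + (c^-1)%:E *
    (W omega * log_plus (W omega) + N omega * log_plus (N omega))))).
  apply: ge0_le_integral => //.
  - by move=> omega _; apply: nneseries_ge0 => n _ _; rewrite mule_ge0 ?ind_ge0.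
  - apply: (ge0_emeasurable_sum (P := xpredT)) => n.
      by move=> omega _ _; rewrite mule_ge0 ?ind_ge0.
    by move=> _; exact: emeasurable_funM.
  - by apply: emeasurable_funD => //; apply: emeasurable_funM => //; exact: emeasurable_funD.
  - move=> omega _; apply: le_trans (mule_exceedance_count_le _ c0 (W0 omega)) _.
    apply: leeD => //; apply: lee_wpmul2l; first by [].
    exact: mule_log_plus_le (W0 _) (N0 _).
rewrite ge0_integralD//; last 2 first.
- move=> omega _; rewrite mule_ge0//.
  by rewrite adde_ge0// mule_ge0// log_plus_ge0.
- by apply: emeasurable_funM => //; exact: emeasurable_funD.
rewrite lte_add_pinfty//; first exact: mean_expsum_lty.
rewrite ge0_integralZl//; last 2 first.
- exact: emeasurable_funD.
- by move=> omega _; rewrite adde_ge0// mule_ge0// log_plus_ge0.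
apply: lte_mul_pinfty => //.
rewrite ge0_integralD//; last 2 first.
- by move=> omega _; rewrite mule_ge0// log_plus_ge0.
- by move=> omega _; rewrite mule_ge0// log_plus_ge0.
rewrite lte_add_pinfty//.
rewrite (eq_integral (fun omega => Z z 1 omega setT * log_plus (Z z 1 omega setT)))//.
by move=> omega _; rewrite (Z1E z_family).
Qed.

End tilted_tail.

(** * Measurability of the decoration and the mean of its truncation *)

Section decoration.
Context {R : realType} {d0 : measure_display} {Omega0 : measurableType d0}.
Variables (P0 : probability Omega0 R) (z : seq nat -> Omega0 -> sequence_space R).
Context {d : measure_display} {Omega : measurableType d}.
Variables (P : probability Omega R)
  (b : nat -> Omega -> sequence_space R) (w : nat -> Omega -> nat)
  (V : nat * nat -> Omega -> field_space R).
Hypotheses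
  (mb : forall k, measurable_fun setT (b k))
  (mw : forall k, measurable_fun setT (w k))
  (mV : forall ik, measurable_fun setT (V ik)).

(** The preimage splits over the countably many values of the index. Used for the spine steps
    [b k omega (w k omega)]. *)
Lemma measurable_random_index (X : nat -> Omega -> \bar R) (n : Omega -> nat) :
  (forall j, measurable_fun setT (X j)) -> measurable_fun setT n ->
  measurable_fun setT (fun omega => X (n omega) omega).
Proof.
move=> mX mn _ A mA; rewrite setTI.
rewrite (_ : _ @^-1` A = \bigcup_j (n @^-1` [set j] `&` X j @^-1` A)).
  apply: bigcup_measurable => j _; apply: measurableI; rewrite -[X in measurable X]setTI.
    exact: mn.
  exact: mX.
apply/seteqP; split => [omega /= An|omega [j _ [/= <-]]//].
by exists (n omega).
Qed.

Lemma atom_setT (x : \bar R) : atom x setT = ind ((-oo < x) && (x < +oo)).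
Proof. by case: x => [r| |] /=; rewrite ?diracT ?ltNyr ?ltry// ltxx ?andbF. Qed.

Lemma measurable_sibling (k i : nat) :
  measurable_fun setT (fun omega => b k omega i).
Proof. exact: (measurableT_comp (measurable_coordinate i) (mb k)). Qed.

Lemma measurable_position (ik : nat * nat) (u : seq nat) :
  measurable_fun setT (fun omega => V ik omega u).
Proof. exact: (measurableT_comp (measurable_coordinate u) (mV ik)). Qed.

Lemma measurable_Dinf : measurable_fun setT (fun omega => Dinf b w V omega setT).
Proof.
apply: emeasurable_funD => //.
apply: (ge0_emeasurable_sum (P := xpredT)) => k.
  move=> omega _ _; apply: esum_ge0 => i _; apply: esum_ge0 => u _.
  by rewrite atom_setT ind_ge0.
(* The index set depends on [omega] through the mark, so the condition is moved into the summand. *)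
move=> _; under eq_fun do rewrite esum_mkcond.
apply: measurable_esum => i; last first.
  move=> omega; case: ifP => // _; apply: esum_ge0 => u _.
  by rewrite atom_setT ind_ge0.
rewrite (_ : (fun omega => _) = (fun omega => if i != w k omega then
  \esum_(u in [set u : seq nat | size u = k])
    ind ((-oo < b k omega i + V (i, k) omega u - spine_sum b w k.+1 omega) &&
         (b k omega i + V (i, k) omega u - spine_sum b w k.+1 omega < +oo)) else 0)).
  apply: measurable_fun_ifT => //.
    have : measurable_fun setT (fun n : nat => i != n) by [].
    by move=> /measurableT_comp; apply.
  apply: measurable_esum => u; last by move=> omega; exact: ind_ge0.
  have m_pos : measurable_fun setT
      (fun omega => b k omega i + V (i, k) omega u - spine_sum b w k.+1 omega).
    apply: emeasurable_funB; first apply: emeasurable_funD.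
    - exact: measurable_sibling.
    - exact: measurable_position.
    - apply: emeasurable_sum => j.
      exact: measurable_random_index (measurable_sibling j) (mw j).
  by apply: measurable_ind; apply: measurable_and; apply: measurable_fun_lte.
apply/funext => omega; case: ifPn => [|]; rewrite ?inE ?notin_setE /=.
  by move=> /eqP ->; apply: eq_esum => u _; rewrite atom_setT.
by move=> /contrapT ->; rewrite eqxx.
Qed.

Hypotheses (z_family : reproduction_family P0 z)
  (V_law : forall ik, same_law P (V ik) P0 (brw z))
  (bw_V_independent :
      independent2 P
        ((fun omega k => (b k omega, w k omega))
          : Omega -> prodspace nat (sequence_space R * nat)%type)
        ((fun omega ik => V ik omega)
          : Omega -> prodspace (nat * nat) (field_space R))).
Variables (m : R) (r : nat -> R).
Hypothesis mean_m : \int[P0]_omega expsum z 0 1 omega = m%:E.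
Hypothesis r_ge0 : forall k, (0 <= r k)%R.

(** The truncation looks at the sequence [b k] only, which keeps it independent of the attached
    walks. *)
Definition tame_sibling (k i : nat) (x : sequence_space R) : bool :=
  (-oo < x i) && (alive_count x <= (r k)%:E).

(** The marked child is included, so the mark disappears; this only enlarges the upper bound. *)
Definition tame_population (omega : Omega) : \bar R :=
  \sum_(k <oo) \esum_(i in setT) \esum_(u in [set u : seq nat | size u = k])
    ind (tame_sibling k i (b k omega) && (-oo < V (i, k) omega u)).

Lemma measurable_tame_sibling (k i : nat) : measurable_fun setT (tame_sibling k i).
Proof.
apply: measurable_and.
  by apply: measurable_alive; exact: measurable_coordinate.
by apply: measurable_fun_lee => //; exact: measurable_alive_count.
Qed.

Lemma measurable_tame_event (k i : nat) (u : seq nat) : measurable_fun setT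
  (fun omega => tame_sibling k i (b k omega) && (-oo < V (i, k) omega u)).
Proof.
apply: measurable_and.
  exact: (measurableT_comp (measurable_tame_sibling k i) (mb k)).
by apply: measurable_alive; exact: measurable_position.
Qed.

Lemma tame_event_prob (k i : nat) (u : seq nat) :
  P [set omega | tame_sibling k i (b k omega) && (-oo < V (i, k) omega u)] =
  P [set omega | tame_sibling k i (b k omega)] *
  P0 [set omega | -oo < brw z omega u].
Proof.
(* Independence is given for the two whole families, so both events are expressed as cylinders in
   the product spaces. *)
pose A : set (prodspace nat (sequence_space R * nat)%type) :=
  [set x | tame_sibling k i (x k).1].
pose B : set (prodspace (nat * nat)%type (field_space R)) := [set v | -oo < v (i, k) u].
have mA : measurable A.
  apply: measurable_bool_set; apply: (measurableT_comp (measurable_tame_sibling k i)).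
  by apply: (measurableT_comp measurable_fst); exact: measurable_coordinate.
have mB : measurable B.
  apply: measurable_bool_set; apply: measurable_alive.
  have mik := @measurable_coordinate _ _ (field_space R) (i, k).
  exact: (measurableT_comp (measurable_coordinate u) mik).
have mBu : measurable [set v : field_space R | -oo < v u].
  by apply: measurable_bool_set; apply: measurable_alive; exact: measurable_coordinate.
have := bw_V_independent mA mB.
rewrite -[X in _ = X * _ -> _]/(P [set omega | tame_sibling k i (b k omega)]).
rewrite -[X in _ = _ * X -> _]/(pushforward P (V (i, k)) [set v : field_space R | -oo < v u]).
rewrite V_law// => <-; congr (P _).
by apply/seteqP; split => omega /= => [/andP[]|[? ?]]; [split|apply/andP].
Qed.

(** The bound already holds pointwise: the number of tame siblings is either 0 or an [alive_count]
    of at most [r k]. *)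
Lemma tame_siblings_mean_le (k : nat) :
  \esum_(i in setT) P [set omega | tame_sibling k i (b k omega)] <= (r k)%:E.
Proof.
have m_tame i : measurable_fun setT (fun omega => tame_sibling k i (b k omega)).
  exact: (measurableT_comp (measurable_tame_sibling k i) (mb k)).
under eq_esum do rewrite -integral_ind//.
rewrite -ge0_integral_esum; last 2 first.
- by move=> i; exact: measurable_ind.
- by move=> i omega; exact: ind_ge0.
rewrite -[leRHS]mule1 -(probability_setT P) -integral_cst//.
apply: ge0_le_integral => //.
- by move=> omega _; apply: esum_ge0 => i _; exact: ind_ge0.
- by apply: measurable_esum => i; [exact: measurable_ind|move=> omega; exact: ind_ge0].
- move=> omega _; under eq_esum do rewrite /tame_sibling andbC ind_and.
  rewrite ge0_esumZl; last 3 first.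
  - by move=> i; exact: ind_ge0.
  - exact: ind_ge0.
  - by rewrite /ind; case: ifP.
  rewrite -/(alive_count (b k omega)) /ind; case: ifP => [|_]; rewrite ?mul1e//.
  by rewrite mul0e lee_fin.
Qed.

Lemma tame_population_ge0 (omega : Omega) : 0 <= tame_population omega.
Proof.
apply: nneseries_ge0 => k _ _; apply: esum_ge0 => i _; apply: esum_ge0 => u _.
exact: ind_ge0.
Qed.

Lemma measurable_tame_population : measurable_fun setT tame_population.
Proof.
apply: (ge0_emeasurable_sum (P := xpredT)) => k.
  by move=> omega _ _; apply: esum_ge0 => i _; apply: esum_ge0 => u _; exact: ind_ge0.
move=> _; apply: measurable_esum => i; last first.
  by move=> omega; apply: esum_ge0 => u _; exact: ind_ge0.
apply: measurable_esum => u; last by move=> omega; exact: ind_ge0.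
by apply: measurable_ind; exact: measurable_tame_event.
Qed.

(** By Tonelli and independence, generation [k] contributes the mean number of tame siblings, at
    most [r k], times the mean size [m^k] of each attached generation. *)
Lemma mean_tame_population_le :
  \int[P]_omega tame_population omega <= \sum_(k <oo) (m ^+ k * r k)%:E.
Proof.
rewrite /tame_population integral_nneseries//; last 2 first.
- move=> k; apply: measurable_esum => i; last first.
    by move=> omega; apply: esum_ge0 => u _; exact: ind_ge0.
  apply: measurable_esum => u; last by move=> omega; exact: ind_ge0.
  by apply: measurable_ind; exact: measurable_tame_event.
- move=> k omega _; apply: esum_ge0 => i _; apply: esum_ge0 => u _; exact: ind_ge0.
apply: lee_nneseries => [k _ _|k _].
  apply: integral_ge0 => omega _; apply: esum_ge0 => i _; apply: esum_ge0 => u _.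
  exact: ind_ge0.
rewrite ge0_integral_esum; last 2 first.
- move=> i; apply: measurable_esum => u; last by move=> omega; exact: ind_ge0.
  by apply: measurable_ind; exact: measurable_tame_event.
- by move=> i omega; apply: esum_ge0 => u _; exact: ind_ge0.
have m_ge0 : 0 <= m%:E.
  by rewrite -mean_m; apply: integral_ge0 => omega _; exact: expsum_ge0.
have inner i : \int[P]_omega (\esum_(u in [set u : seq nat | size u = k])
    ind (tame_sibling k i (b k omega) && (-oo < V (i, k) omega u))) =
    (m ^+ k)%:E * P [set omega | tame_sibling k i (b k omega)].
  rewrite ge0_integral_esum; last 2 first.
  - by move=> u; apply: measurable_ind; exact: measurable_tame_event.
  - by move=> u omega; exact: ind_ge0.
  have event u : \int[P]_omega
      ind (tame_sibling k i (b k omega) && (-oo < V (i, k) omega u)) =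
      P [set omega | tame_sibling k i (b k omega)] * P0 [set omega | -oo < brw z omega u].
    by rewrite integral_ind; [exact: tame_event_prob|exact: measurable_tame_event].
  under eq_esum do rewrite event.
  rewrite ge0_esumZl//; last first.
    apply: fin_num_measure; apply: measurable_bool_set.
    exact: (measurableT_comp (measurable_tame_sibling k i) (mb k)).
  by rewrite (mean_generation_size z_family) ?mean_m// muleC EFin_expe.
under eq_esum do rewrite inner.
rewrite ge0_esumZl//; last by rewrite lee_fin exprn_ge0.
rewrite EFinM; apply: lee_wpmul2l; first by rewrite lee_fin exprn_ge0.
exact: tame_siblings_mean_le.
Qed.

(** When every [b k] obeys the bound, the truncation removes nothing; the leading 1 is the atom at
    0. *)
Lemma Dinf_le_tame (omega : Omega) :
  (forall k, alive_count (b k omega) <= (r k)%:E) ->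
  Dinf b w V omega setT <= 1 + tame_population omega.
Proof.
move=> br; rewrite /Dinf diracT; apply: leeD => //.
apply: lee_nneseries => [k _ _|k _].
  by apply: esum_ge0 => i _; apply: esum_ge0 => u _; rewrite atom_setT ind_ge0.
rewrite esum_mkcond. apply: le_esum => i _; case: ifP => _; last first.
  by apply: esum_ge0 => u _; exact: ind_ge0.
apply: le_esum => u _; rewrite atom_setT /tame_sibling br andbT /ind.
(* A position above [-oo] forces both the sibling and the vertex of its walk to be alive, whatever
   the spine shift. *)
case: ifP => [/andP[+ _]|_]; last by case: ifP => _ //; exact: lee01.
case: (b k omega i) => [x| |] //=; rewrite ?ltNyr ?ltNyy//=.
- by case: (V (i, k) omega u) => [y| |] //= _; rewrite ?ltNyr ?ltNye ?lexx.
- by case: (V (i, k) omega u) => [y| |] //= _; rewrite ?ltNyr ?ltNye ?lexx.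
Qed.

End decoration.

(** * Two elementary bounds *)

(** The finitely many exceptions are absorbed into the constant. A natural number [C] leaves only
    countably many cases to treat almost surely. *)
Lemma linear_bound_of_eventually {R : realType} (x : nat -> \bar R) (r : nat -> R) :
  (forall k, 1 <= r k)%R -> (forall k, x k < +oo) ->
  (exists K, forall k, (K <= k)%N -> x k <= (r k)%:E) ->
  exists C : nat, forall k, x k <= (C%:R * r k)%:E.
Proof.
move=> r1 xfin [K xr].
have r0 k : (0 <= r k)%R by exact: le_trans (r1 k).
have [C xC] : exists C : nat, forall k, (k < K)%N -> x k <= C%:R%:E.
  elim: K {xr} => [|K [C xC]]; first by exists 0%N.
  have [D xD] : exists D : nat, x K <= D%:R%:E.
    have := xfin K; case: (x K) => [y _| |_]//; last by exists 0%N; exact: leNye.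
    exists (Num.bound `|y|%R); rewrite lee_fin ltW//.
    by rewrite (le_lt_trans (ler_norm _))// archi_boundP.
  exists (maxn C D) => k; rewrite ltnS leq_eqVlt => /orP[/eqP ->|/xC kC].
    by rewrite (le_trans xD)// lee_fin ler_nat leq_maxr.
  by rewrite (le_trans kC)// lee_fin ler_nat leq_maxl.
(* The successor makes the constant at least 1, as needed for the indices beyond [K]. *)
exists C.+1 => k; have [kK|Kk] := ltnP k K.
  rewrite (le_trans (xC k kK))// lee_fin.
  rewrite (@le_trans _ _ C.+1%:R%R) ?ler_nat//.
  by rewrite ler_peMr// ler0n.
by rewrite (le_trans (xr k Kk))// lee_fin ler_peMl// ler1n.
Qed.

Lemma geometric_nneseries_lty {R : realType} (C q : R) :
  (0 <= C)%R -> (0 <= q < 1)%R -> \sum_(k <oo) (C * q ^+ k)%:E < +oo.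
Proof.
move=> C0 /andP[q0 q1].
rewrite (@le_lt_trans _ _ (C * (1 - q)^-1)%:E) ?ltry//.
apply: lime_le.
  by apply: is_cvg_nneseries => n _ _; rewrite lee_fin mulr_ge0// exprn_ge0.
apply: nearW => n; rewrite sumEFin lee_fin big_mkord -mulr_sumr.
apply: ler_wpM2l => //.
rewrite -[leRHS]mul1r ler_pdivlMr ?subr_gt0//.
have := subrX1 q n; have : (0 <= q ^+ n)%R by exact: exprn_ge0.
by lra.
Qed.

(** * Almost sure finiteness of the decoration *)

Theorem proposition5p1 (R : realType)
    (d0 : measure_display) (Omega0 : measurableType d0)
    (P0 : probability Omega0 R)
    (z : seq nat -> Omega0 -> sequence_space R)
    (d : measure_display) (Omega : measurableType d)
    (P : probability Omega R)
    (b : nat -> Omega -> sequence_space R) (w : nat -> Omega -> nat)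
    (V : nat * nat -> Omega -> field_space R)
    (theta : R)
    (z_family : reproduction_family P0 z)
    (z_nontrivial : P0 [set omega | Z z 1 omega setT = 0] < 1)
    (b_ranked : forall k omega, ranked (b k omega))
    (bw_law : forall k, has_tilted_law P0 z theta P (b k) (w k))
    (bw_iid : iid P (fun k omega => (b k omega, w k omega)))
    (V_lty : forall ik omega u, V ik omega u < +oo)
    (V_law : forall ik, same_law P (V ik) P0 (brw z))
    (V_iid : iid P V)
    (bw_V_independent :
      independent2 P
        ((fun omega k => (b k omega, w k omega))
          : Omega -> prodspace nat (sequence_space R * nat)%type)
        ((fun omega ik => V ik omega)
          : Omega -> prodspace (nat * nat) (field_space R)))
    (theta_gt0 : (0 < theta)%R)
    (psi_theta_lty : psi P0 z theta < +oo)
    (xlogx_theta :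
      \int[P0]_omega (expsum z theta 1 omega *
                      log_plus (expsum z theta 1 omega)) < +oo)
    (subcritical : psi P0 z 0 < 0)
    (xlogx_Z :
      \int[P0]_omega (Z z 1 omega setT * log_plus (Z z 1 omega setT)) < +oo) :
  P [set omega | Dinf b w V omega setT < +oo] = 1.
Proof.
have [mbw _ _] := bw_iid; have [mV _ _] := V_iid.
have mb k : measurable_fun setT (b k) := measurableT_comp measurable_fst (mbw k).
have mw k : measurable_fun setT (w k) := measurableT_comp measurable_snd (mbw k).
have [m mean_m /andP[m0 m1]] : exists2 m : R,
    \int[P0]_omega expsum z 0 1 omega = m%:E & (0 <= m < 1)%R.
  have : 0 <= \int[P0]_omega expsum z 0 1 omega.
    by apply: integral_ge0 => omega _; exact: expsum_ge0.
  move: subcritical; rewrite /psi lne_lt0.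
  by case: integral => // m; rewrite lte_fin lee_fin => m1 m0; exists m => //; rewrite m0.
have psi_fin := psi_fin_num z_family theta_gt0 psi_theta_lty z_nontrivial.
(* Chosen so that [a = e^c] satisfies both [a > 1] and [a m = 2m / (1 + m) < 1]. *)
pose c := ln (2 / (1 + m)).
have a1 : (1 < 2 / (1 + m))%R by rewrite ltr_pdivlMr; lra.
have c0 : (0 < c)%R by exact: ln_gt0.
have expc : expR c = (2 / (1 + m))%R by rewrite lnK// posrE; lra.
(* The reindexing [j] serves twice: the identity gives the eventual bound [a^k], and a constant [j]
   shows that a single [alive_count] is almost surely finite. *)
have tail (j : nat -> nat) : {ae P, forall omega, exists K, forall n, (K <= n)%N ->
    ~ ((expR c ^+ n)%:E < alive_count (b (j n) omega))}.
  apply: (borel_cantelli (A := fun n =>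
    [set omega | (expR c ^+ n)%:E < alive_count (b (j n) omega)])).
    move=> n; apply: measurable_bool_set; apply: measurable_fun_lte => //.
    exact: (measurableT_comp measurable_alive_count (mb _)).
  exact: (alive_count_tail_summable z_family theta_gt0 psi_theta_lty psi_fin
    (fun n => bw_law (j n)) (fun n => mb (j n)) xlogx_theta xlogx_Z c0).
pose r (C : nat) k : R := (C%:R * expR c ^+ k)%R.
have r0 C k : (0 <= r C k)%R by rewrite mulr_ge0// exprn_ge0// expR_ge0.
have mDinf : measurable_fun setT (fun omega => Dinf b w V omega setT).
  exact: measurable_Dinf.
apply: ae_probability1.
  by apply: measurable_bool_set; exact: measurable_fun_lte.
have tame_lty : {ae P, forall omega, forall C, tame_population b V (r C) omega < +oo}.
  apply: ae_foralln => C; apply: ae_lty.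
  - exact: measurable_tame_population.
  - by move=> omega; exact: tame_population_ge0.
  - apply: le_lt_trans (mean_tame_population_le mb mV z_family V_law
      bw_V_independent mean_m (r0 C)) _.
    (* The terms become [C (m a)^k], a convergent geometric series. *)
    under eq_eseriesr => k _ do rewrite mulrCA -exprMn.
    apply: geometric_nneseries_lty; first exact: ler0n.
    rewrite expc mulr_ge0 ?divr_ge0 ?addr_ge0//=.
    by rewrite mulrA ltr_pdivrMr; lra.
have tail_const := ae_foralln (fun k => tail (fun=> k)).
have tail_id := tail id.
apply: filterS3 tame_lty tail_const tail_id => omega tame bfin [K bK].
have [C bC] : exists C : nat, forall k,
    alive_count (b k omega) <= (C%:R * expR c ^+ k)%:E.
  apply: linear_bound_of_eventually.
  - by move=> k; rewrite exprn_ege1// expc ltW.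
  (* The threshold [L] for the constant index [k] bounds this count by the real number [a^L]. *)
  - move=> k; have [L /(_ L (leqnn L)) /negP] := bfin k.
    by rewrite -leNgt => /le_lt_trans; apply; exact: ltry.
  - by exists K => k /bK /negP; rewrite -leNgt.
apply: le_lt_trans (Dinf_le_tame w V bC) _.
by apply: lte_add_pinfty; [exact: ltry|exact: tame C].
Qed.
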